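(* Let $(U_t)_{t\in\mathbb R}$ be a reflection positive unitary one-parameter group on the reflection positive Hilbert space $(\mathcal E,\mathcal E_+,\theta)$. Suppose that $\mathcal E_+$ is $U$-cyclic (i.e. $\bigcup_{t\in\mathbb R}U_t\mathcal E_+$ spans a dense subspace of $\mathcal E$), and let $(\hat U_t)_{t\ge 0}$ be the corresponding one-parameter semigroup of contractions on $\hat{\mathcal E}$. Let $\mathcal E_{\rm fix}$ be the subspace of elements of $\mathcal E$ fixed under all $U_t$, $t\in\mathbb R$, and $\hat{\mathcal E}_{\rm fix}$ the subspace of elements of $\hat{\mathcal E}$ fixed by the semigroup $(\hat U_t)_{t>0}$. Then: (a) $\mathcal E_{\rm fix}\subseteq \mathcal E_0:=\{\xi\in\mathcal E_+ : \theta\xi=\xi\}$. (b) The map $q|_{\mathcal E_{\rm fix}}:\mathcal E_{\rm fix}\to\hat{\mathcal E}_{\rm fix}$, $v\mapsto \hat v$, is a unitary isomorphism. (c) $\mathcal E_{\rm fix}=\mathcal E_\infty:=\bigcap_{t>0}U_t\mathcal E_+$.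
   Context: A reflection positive Hilbert space is a triple $(\mathcal E,\mathcal E_+,\theta)$ where $\mathcal E$ is a Hilbert space, $\theta$ is a unitary involution on $\mathcal E$ and $\mathcal E_+\subseteq\mathcal E$ is a closed subspace with $\langle\eta,\theta\eta\rangle\ge 0$ for all $\eta\in\mathcal E_+$. Put $\mathcal N:=\{\eta\in\mathcal E_+:\langle\eta,\theta\eta\rangle=0\}$; $\hat{\mathcal E}$ is the Hilbert completion of $\mathcal E_+/\mathcal N$ with respect to the norm $\|\hat\eta\|=\sqrt{\langle\eta,\theta\eta\rangle}$, and $q:\mathcal E_+\to\hat{\mathcal E}$, $\eta\mapsto\hat\eta$, is the canonical map. A reflection positive unitary one-parameter group on $(\mathcal E,\mathcal E_+,\theta)$ is a strongly continuous unitary one-parameter group $(U_t)_{t\in\mathbb R}$ on $\mathcal E$ with $U_t\mathcal E_+\subseteq\mathcal E_+$ for $t>0$ and $\theta U_t\theta=U_{-t}$ for $t\in\mathbb R$. Then, for $t\ge 0$, $\hat U_t\hat\eta:=\widehat{U_t\eta}$ ($\eta\in\mathcal E_+$) determines a strongly continuous one-parameter semigroup $(\hat U_t)_{t\ge0}$ of symmetric contractions on $\hat{\mathcal E}$. *)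

(* Defs.v *)
From HB Require Import structures.
From mathcomp Require Import all_boot all_order all_algebra.
From mathcomp Require Import sesquilinear complex.
From mathcomp Require Import all_classical all_reals all_analysis.

Set Implicit Arguments.
Unset Strict Implicit.
Unset Printing Implicit Defensive.

Import Order.TTheory GRing.Theory Num.Theory.
Import numFieldNormedType.Exports.

Local Open Scope classical_set_scope.
Local Open Scope ring_scope.
Local Open Scope complex_scope.

(* Complex Hilbert spaces. The inner product is linear in the first argument
   and conjugate-linear in the second. Norms take their values in R[i], where
   [0 <= z] means that z is real and nonnegative. *)
HB.mixin Record isHilbert (R : realType) (E : Type)
    of CompleteNormedModule R[i] E := {
  inner : {dot E for (@Num.conj R[i])} ;
  inner_norm : forall x : E, inner x x = `|x| ^+ 2 }.

#[short(type="hilbertType")]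
HB.structure Definition Hilbert (R : realType) :=
  { E of isHilbert R E & CompleteNormedModule R[i] E }.

Section ReflectionPositivity.
Context {R : realType}.
Implicit Types E F : hilbertType R.

Definition linear_on E F (A : set E) (f : E -> F) : Prop :=
  forall (a : R[i]) x y, A x -> A y -> f (a *: x + y) = a *: f x + f y.

(* f is a unitary isomorphism of the linear subspace A onto the linear
   subspace B; the values of f outside A are irrelevant. *)
Definition unitary_iso E F (A : set E) (B : set F) (f : E -> F) : Prop :=
  [/\ linear_on A f,
      forall x y, A x -> A y -> inner (f x) (f y) = inner x y
    & set_bij A B f].

Definition linear_span E (A : set E) : set E :=
  smallest (fun M : set E => submod_closed [in M]) A.

Record reflection_positive_space E (Ep : set E) (theta : {linear E -> E}) : Prop :=
  { rp_theta_unitary : unitary_iso setT setT theta ;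
    rp_theta_invol : involutive theta ;
    rp_subspace : submod_closed [in Ep] ;
    rp_closed : closed Ep ;
    rp_ge0 : forall x, Ep x -> 0 <= inner x (theta x) }.

(* (Ehat, q) is a Hilbert completion of Ep / N for the norm
   sqrt <x, theta x>, where N = {x in Ep | <x, theta x> = 0}, and q is the
   composite Ep -> Ep / N -> Ehat; in particular N is the kernel of q on Ep.
   A completion being unique up to a unitary isomorphism, it is given by this
   specification. The values of q outside Ep are irrelevant. *)
Record os_completion E (Ep : set E) (theta : {linear E -> E})
    (Ehat : hilbertType R) (q : E -> Ehat) : Prop :=
  { os_linear : linear_on Ep q ;
    os_norm : forall x, Ep x -> `|q x| = sqrtC (inner x (theta x)) ;
    os_dense : dense (q @` Ep) }.

Record unitary_group E (U : R -> {linear E -> E}) : Prop :=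
  { ug_unitary : forall t, unitary_iso setT setT (U t) ;
    ug_0 : forall x, U 0 x = x ;
    ug_add : forall s t x, U (s + t) x = U s (U t x) ;
    ug_continuous : forall x, continuous (fun t : R => U t x) }.

Record reflection_positive_group E (Ep : set E) (theta : {linear E -> E})
    (U : R -> {linear E -> E}) : Prop :=
  { rpg_group : unitary_group U ;
    rpg_stable : forall t, 0 < t -> U t @` Ep `<=` Ep ;
    rpg_theta : forall t x, theta (U t (theta x)) = U (- t) x }.

(* Since q @` Ep is dense, Uhat t is determined by these conditions for every
   t >= 0 (and so are the semigroup law, the symmetry and the strong
   continuity); Uhat t is irrelevant for t < 0. *)
Record os_semigroup E (Ep : set E) (U : R -> {linear E -> E})
    (Ehat : hilbertType R) (q : E -> Ehat)
    (Uhat : R -> {linear Ehat -> Ehat}) : Prop :=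
  { oss_contraction : forall t, 0 <= t -> forall v, `|Uhat t v| <= `|v| ;
    oss_intertwine : forall t, 0 <= t ->
      forall x, Ep x -> Uhat t (q x) = q (U t x) }.

Definition cyclic_subspace E (U : R -> {linear E -> E}) (A : set E) : Prop :=
  dense (linear_span (\bigcup_t (U t @` A))).

Definition fixed_vectors E (U : R -> {linear E -> E}) (T : set R) : set E :=
  [set x | forall t, T t -> U t x = x].

End ReflectionPositivity.

(* Main.v *)
(* (a) A fixed vector v is as close to y as it is to U_t y, so density of the
   union of the U_t Ep (a directed union) puts v in the closed space Ep. Then
   w = v - theta v is fixed, hence in Ep, and 0 <= <w, theta w> = - |w|^2.
   (b) By (a), q is isometric on fixed vectors. If w is fixed by Uhat, let v in
   Ep represent x |-> <q x, w> on Ep: symmetry of Uhat gives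
   <U_t v, v> = <v, v>, so v is fixed, and q v = w by density of q(Ep).
   (c) If the whole orbit of y lies in Ep, then t |-> <U_t y, theta y> is bounded
   and midpoint convex, hence constant, so z = U_s y - y has its orbit in the
   kernel of q. Hence theta z is orthogonal to every U_r Ep, and z = 0. *)
Require Import Defs.
From mathcomp Require Import all_boot all_order all_algebra.
From mathcomp Require Import all_classical all_reals all_analysis.
From mathcomp Require Import sesquilinear complex ring lra.
Set Implicit Arguments.
Unset Strict Implicit.
Unset Printing Implicit Defensive.
Import Order.TTheory GRing.Theory Num.Theory.
Import numFieldNormedType.Exports.
Local Open Scope classical_set_scope.
Local Open Scope ring_scope.

(** * Real part of the inner product and approximation in norm *)

Section RealInnerProduct.
Context {R : realType}.
Implicit Types (E F : hilbertType R) (r : R).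

(** Real parts take values in the ordered field [R], where inequalities combine linearly;
    [inner_ext] recovers complex identities from real ones. *)
Definition re_inner {E} (x y : E) : R := complex.Re (inner x y).

Lemma re_inner_linear E (z : E) r (x y : E) :
  re_inner (r%:C%C *: x + y) z = r * re_inner x z + re_inner y z.
Proof.
rewrite /re_inner linearPl /=.
by case: (inner x z) => a b; case: (inner y z) => c d /=; rewrite mul0r subr0.
Qed.

Lemma re_innerC E (x y : E) : re_inner x y = re_inner y x.
Proof.
rewrite /re_inner (hermC inner) expr0 mul1r.
have Re_conj (z : R[i]) : complex.Re (Num.conj z) = complex.Re z by case: z.
exact: Re_conj.
Qed.

Lemma re_innerDl E (x y z : E) :
  re_inner (x + y) z = re_inner x z + re_inner y z.
Proof. by have := re_inner_linear z 1 x y; rewrite scale1r mul1r. Qed.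

Lemma re_inner0l E (z : E) : re_inner 0 z = 0.
Proof. by have := re_innerDl 0 0 z; rewrite addr0; lra. Qed.

Lemma re_innerZl E r (x z : E) : re_inner (r%:C%C *: x) z = r * re_inner x z.
Proof. by have := re_inner_linear z r x 0; rewrite re_inner0l !addr0. Qed.

Lemma re_innerNl E (x z : E) : re_inner (- x) z = - re_inner x z.
Proof. by have := re_innerDl x (- x) z; rewrite subrr re_inner0l; lra. Qed.

Lemma re_innerDr E (x y z : E) :
  re_inner z (x + y) = re_inner z x + re_inner z y.
Proof. by rewrite !(re_innerC z) re_innerDl. Qed.

Lemma re_innerZr E r (x z : E) : re_inner z (r%:C%C *: x) = r * re_inner z x.
Proof. by rewrite !(re_innerC z) re_innerZl. Qed.

Lemma re_innerNr E (x z : E) : re_inner z (- x) = - re_inner z x.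
Proof. by rewrite !(re_innerC z) re_innerNl. Qed.

Definition re_innerE := (re_innerDl, re_innerDr, re_innerNl, re_innerNr,
  re_innerZl, re_innerZr).

Lemma Im_inner E (x y : E) :
  complex.Im (inner x y) = - re_inner ('i%C *: x) y.
Proof.
rewrite /re_inner linearZl_LR /=.
by case: (inner x y) => a b /=; rewrite mul0r mul1r sub0r opprK.
Qed.

Lemma inner_ext E F (x y : E) (u v : F) :
  re_inner x y = re_inner u v ->
  re_inner ('i%C *: x) y = re_inner ('i%C *: u) v -> inner x y = inner u v.
Proof.
move=> hre him; apply/eqP; rewrite eq_complex !Im_inner him eqxx andbT.
by rewrite -/(re_inner x y) hre.
Qed.

Lemma sqr_normE E (x : E) : `|x| ^+ 2 = (re_inner x x)%:C%C.
Proof.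
by rewrite /re_inner inner_norm RRe_real.
Qed.

Lemma re_inner_ge0 E (x : E) : 0 <= re_inner x x.
Proof. by rewrite -lecR -sqr_normE exprn_ge0. Qed.

Lemma re_inner_eq0 E (x : E) : re_inner x x <= 0 -> x = 0.
Proof.
move=> h; have h0 : re_inner x x = 0.
  by apply/eqP; rewrite eq_le h re_inner_ge0.
by apply/eqP; rewrite -normr_eq0 -sqrf_eq0 sqr_normE h0.
Qed.

(** Expand [|r x - y|^2 >= 0] and divide by [r]. With its free weight, this replaces the
    Cauchy-Schwarz inequality in the estimates below. *)
Lemma re_inner_young E r (x y : E) : 0 < r ->
  2 * re_inner x y <= r * re_inner x x + r^-1 * re_inner y y.
Proof.
move=> r0; have := re_inner_ge0 (r%:C%C *: x - y).
rewrite !re_innerE (re_innerC y x) => h.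
rewrite -(ler_pM2l r0) mulrDr mulVKf ?gt_eqF//.
by lra.
Qed.

Lemma ball_re_inner E (x y : E) r : 0 < r ->
  ball x r%:C%C y <-> re_inner (x - y) (x - y) < r ^+ 2.
Proof.
move=> r0; rewrite -ball_normE /ball_ /=.
rewrite -(ltr_pXn2r (n := 2)) ?nnegrE ?normr_ge0 ?lecR ?(ltW r0)//.
by rewrite sqr_normE -rmorphXn ltcR.
Qed.

Lemma dense_approx E (S : set E) (x : E) r : dense S -> 0 < r ->
  exists2 y, S y & re_inner (x - y) (x - y) < r ^+ 2.
Proof.
move=> dS r0.
have rC0 : 0 < r%:C%C by rewrite ltcR.
have [|y [yb Sy]] := dS _ _ (open_interior (ball x r%:C%C)).
  by exists x; apply: nbhsx_ballx.
by exists y => //; apply/ball_re_inner => //; apply: interior_subset.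
Qed.

Lemma closed_approx E (A : set E) (x : E) : closed A ->
  (forall r, 0 < r -> exists2 y, A y & re_inner (x - y) (x - y) < r ^+ 2) ->
  A x.
Proof.
move=> cA h; apply: cA => B /nbhs_ballP[e /= e0 eB].
have er : e = (complex.Re e)%:C%C by rewrite RRe_real // gtr0_real.
have r0 : 0 < complex.Re e by rewrite -ltcR -er.
have [y Ay hy] := h _ r0.
by exists y; split => //; apply: eB; rewrite er; apply/ball_re_inner.
Qed.

(** A point [s] of [S] closer to [u] than [|u|] would contradict [|u - s|^2 = |u|^2 + |s|^2]. *)
Lemma dense_orthogonal E (S : set E) (u : E) : dense S ->
  (forall s, S s -> re_inner s u = 0) -> u = 0.
Proof.
move=> dS h; apply: re_inner_eq0; rewrite leNgt; apply/negP => u0.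
have r0 : 0 < Num.sqrt (re_inner u u) by rewrite sqrtr_gt0.
have [s Ss] := dense_approx u dS r0.
rewrite sqr_sqrtr ?(ltW u0)// !re_innerE (re_innerC u s) (h s Ss).
by have := re_inner_ge0 s; lra.
Qed.

End RealInnerProduct.

(** * Subspaces, Riesz representation and elementary real inequalities *)

Section Subspaces.
Context {R : realType}.
Implicit Types (E : hilbertType R) (r : R).

Lemma subspaceP E (A : set E) : submod_closed [in A] <->
  [/\ A 0, forall x y, A x -> A y -> A (x + y)
    & forall (a : R[i]) x, A x -> A (a *: x)].
Proof.
split=> [[A0 Al]|[A0 AD AZ]].
  have {}A0 : A 0 by apply: set_mem.
  have {}Al a x y : A x -> A y -> A (a *: x + y).
    by move=> Ax Ay; apply: set_mem; apply: Al; apply: mem_set.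
  split=> // [x y Ax Ay|a x Ax].
    by rewrite -(scale1r x); apply: Al.
  by rewrite -(addr0 (a *: x)); apply: Al.
split; first exact: mem_set.
move=> a x y /set_mem Ax /set_mem Ay.
by apply: mem_set; apply: AD => //; apply: AZ.
Qed.

Lemma subspaceN E (A : set E) x : submod_closed [in A] -> A x -> A (- x).
Proof. by move=> /subspaceP[_ _ AZ] Ax; rewrite -scaleN1r; apply: AZ. Qed.

Lemma subspaceB E (A : set E) x y :
  submod_closed [in A] -> A x -> A y -> A (x - y).
Proof.
move=> sA Ax Ay; have /subspaceP[_ AD _] := sA.
by apply: AD => //; apply: subspaceN.
Qed.

Lemma ge0_quadratic_linear0 (p c : R) :
  (forall a, 0 <= a ^+ 2 * p + a * c) -> c = 0.
Proof.
move=> h; have p0 : 0 <= p by have := h 1; have := h (-1); lra.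
have p1 : 0 < p + 1 by lra.
(* For [p > 0] the minimizer is [- c / (2 * p)]; [p + 1] keeps the denominator positive when
   [p = 0]. *)
have := h (- c / (2 * (p + 1))).
have -> : (- c / (2 * (p + 1))) ^+ 2 * p + - c / (2 * (p + 1)) * c =
   - (c ^+ 2 * (p + 2) / (4 * (p + 1) ^+ 2)) by field; lra.
rewrite oppr_ge0 => h1; apply/eqP; rewrite -sqrf_eq0 eq_le sqr_ge0 andbT.
move: h1; rewrite ler_pdivrMr ?mul0r; last by nra.
by rewrite pmulr_lle0 //; lra.
Qed.

Lemma le0_eps (c K : R) : (forall a, 0 < a -> c <= a * K) -> c <= 0.
Proof.
move=> h; rewrite leNgt; apply/negP => c0.
have K0 : 0 < K by have := h 1 ltr01; lra.
have := h (c / (2 * K)) (divr_gt0 c0 (mulr_gt0 _ K0)).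
by rewrite (_ : c / _ * _ = c / 2); [lra|field; lra].
Qed.

(* Riesz representation, for the real inner product, on a closed subspace; the
   hypothesis on C is the boundedness of l. The representing vector minimizes
   J x = |x|^2 - 2 l x, and minimizing sequences are Cauchy by the
   parallelogram identity. *)
Lemma riesz_subspace E (A : set E) (l : E -> R) (C : R) :
  submod_closed [in A] -> closed A ->
  (forall x y, A x -> A y -> l (x + y) = l x + l y) ->
  (forall r x, A x -> l (r%:C%C *: x) = r * l x) ->
  (forall x, A x -> 2 * l x <= re_inner x x + C) ->
  exists2 v, A v & forall x, A x -> re_inner x v = l x.
Proof.
move=> sA cA lD lZ lC; have /subspaceP[A0 AD AZ] := sA.
have lB x y : A x -> A y -> l (x - y) = l x - l y.
  move=> Ax Ay; have -> : - y = (-1)%:C%C *: y by rewrite rmorphN1 scaleN1r.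
  by rewrite lD ?lZ ?mulN1r//; apply: AZ.
pose J x := re_inner x x - 2 * l x.
pose m := inf (J @` A).
have mJ x : A x -> m <= J x.
  move=> Ax; apply: ge_inf; last by exists x.
  by exists (- C) => _ [y Ay <-]; have := lC _ Ay; rewrite /J; lra.
have Jm e : 0 < e -> exists2 x, A x & J x < m + e.
  move=> e0; have [|_ [x Ax <-] Jx] := @inf_adherent _ (J @` A) e e0.
    split; first by exists (J 0), 0.
    by exists (- C) => _ [y Ay <-]; have := lC _ Ay; rewrite /J; lra.
  by exists x.
clearbody m.
have JB x y e : A x -> A y -> J x < m + e -> J y < m + e ->
    re_inner (x - y) (x - y) < 4 * e.
  move=> Ax Ay Jx Jy.
  have Axy : A ((2^-1)%:C%C *: (x + y)) by apply/AZ/AD.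
  have := mJ _ Axy; rewrite /J lZ ?lD//; last exact: AD.
  move: Jx Jy; rewrite /J !re_innerE (re_innerC y x); lra.
(* Minimizing sequences are replaced by the filter of sublevel sets of [J] on [A]; completeness
   provides its limit [v]. *)
pose F := filter_from [set e : R | 0 < e]
  (fun e => [set x | A x /\ J x < m + e]).
have FF : ProperFilter F.
  apply: filter_from_proper; last first.
    by move=> e /= /Jm[x Ax Jx]; exists x.
  apply: filter_from_filter; first by exists 1 => /=.
  move=> e f /= e0 f0; exists (Num.min e f) => /=; first by rewrite lt_min e0.
  move=> x /= [Ax]; rewrite -ltrBlDl lt_min => /andP[].
  by rewrite !ltrBlDl.
have /cauchy_cvgP/cvg_ex[v Fv] : cauchy F.
  apply: cauchy_exP => eps eps0.
  have er : eps = (complex.Re eps)%:C%C by rewrite RRe_real // gtr0_real.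
  have r0 : 0 < complex.Re eps by rewrite -ltcR -er.
  have e0 : 0 < complex.Re eps ^+ 2 / 4 by rewrite divr_gt0 ?exprn_gt0.
  have [x Ax Jx] := Jm _ e0.
  exists x, (complex.Re eps ^+ 2 / 4) => //= y [Ay Jy].
  rewrite er; apply/ball_re_inner => //.
  by have := JB _ _ _ Ax Ay Jx Jy; lra.
have near_v e r : 0 < e -> 0 < r ->
    exists x, [/\ A x, J x < m + e & re_inner (v - x) (v - x) < r ^+ 2].
  move=> e0 r0; have rC0 : 0 < r%:C%C by rewrite ltcR.
  have Fb : F (ball v r%:C%C) by apply: Fv; apply: nbhsx_ballx.
  have Fe : F [set x | A x /\ J x < m + e] by exists e.
  have [x [[Ax Jx] /ball_re_inner hx]] := filter_ex (filterI Fe Fb).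
  by exists x; split => //; apply: hx.
have Av : A v.
  apply: closed_approx => // r r0.
  by have [x []] := near_v _ _ ltr01 r0; exists x.
have Jv : J v <= m.
  (* Compare [J v] with [J x] for [x = v - h], [|h| < a]. The bound on [l] at [- a^-1 h] gives
     [2 l (- h) <= a^-1 |h|^2 + a C]. The 3 collects [J x < m + a] and two terms
     [a^-1 |h|^2 <= a]. *)
  rewrite -subr_le0; apply: (@le0_eps _ (re_inner v v + C + 3)) => a a0.
  have [x [Ax Jx hx]] := near_v _ _ a0 a0; pose h := v - x.
  have Ah : A (- h) by apply: (subspaceN sA); apply: subspaceB.
  have {hx} hh : a^-1 * re_inner h h <= a.
    by rewrite ler_pdivrMl // -expr2 ltW.
  have xE : x = v - h by rewrite opprB addrC subrK.
  clearbody h.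
  have := lC _ (AZ a^-1%:C%C _ Ah); rewrite lZ // !re_innerE => lh.
  have {}lh : 2 * l (- h) <= a^-1 * re_inner h h + a * C.
    by rewrite -(ler_pM2l (x := a^-1)) ?invr_gt0// mulrDr mulKf ?gt_eqF//; lra.
  have := re_inner_young v h a0; have := re_inner_ge0 h.
  move: Jx; rewrite {1}xE /J lD //; move: lh hh.
  rewrite !re_innerE (re_innerC h v); lra.
exists v => // x Ax; apply/eqP; rewrite -subr_eq0; apply/eqP.
(* The quadratic is half of [J (v + a x) - J v], nonnegative by minimality; its linear coefficient
   is [<x, v> - l x]. *)
apply: (@ge0_quadratic_linear0 (re_inner x x / 2)) => a.
have := mJ (v + a%:C%C *: x) (AD _ _ Av (AZ _ _ Ax)).
move: Jv; rewrite /J lD ?lZ//; last exact: AZ.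
rewrite !re_innerE (re_innerC v x) expr2; lra.
Qed.

(** By convexity every increment is at least the first one; if that were positive, linear growth
    would exceed [M]. *)
Lemma convex_bounded_nonincreasing (f : nat -> R) (M : R) :
  (forall n, 0 <= f n.+2 - 2 * f n.+1 + f n) -> (forall n, f n <= M) ->
  f 1%N <= f 0%N.
Proof.
move=> fc fM; rewrite leNgt; apply/negP => f01.
have step n : f 1%N - f 0%N <= f n.+1 - f n.
  by elim: n => // n IH; have := fc n; lra.
have lin n : f 0%N + n%:R * (f 1%N - f 0%N) <= f n.
  elim: n => [|n IH]; first by rewrite mul0r addr0.
  by have := step n; rewrite -natr1; lra.
have d0 : 0 < f 1%N - f 0%N by rewrite subr_gt0.
have := lin (Num.truncn ((M - f 0%N) / (f 1%N - f 0%N))).+1.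
have := truncnS_gt ((M - f 0%N) / (f 1%N - f 0%N)).
rewrite ltr_pdivrMr // => h1 h2.
by have := fM (Num.truncn ((M - f 0%N) / (f 1%N - f 0%N))).+1; lra.
Qed.

End Subspaces.

(** * Unitary groups, the quotient map [q] and the contraction semigroup *)

Section OsterwalderSchrader.
Context {R : realType}.
Implicit Types (E F : hilbertType R) (t s : R).

Lemma isometry_re_inner E F (f : E -> F) (x y : E) :
  unitary_iso setT setT f -> re_inner (f x) (f y) = re_inner x y.
Proof. by case=> _ fI _; rewrite /re_inner fI. Qed.

Section UnitaryGroup.
Context {E : hilbertType R} {U : R -> {linear E -> E}}.
Hypothesis gU : unitary_group U.

Lemma unitary_groupVK t : cancel (U (- t)) (U t).
Proof. by move=> x; rewrite -(ug_add gU) subrr (ug_0 gU). Qed.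

Lemma unitary_group_re_inner t (x y : E) :
  re_inner (U t x) (U t y) = re_inner x y.
Proof. exact: isometry_re_inner (ug_unitary gU t). Qed.

Lemma unitary_group_adjoint t (x y : E) :
  re_inner (U t x) y = re_inner x (U (- t) y).
Proof. by rewrite -(unitary_group_re_inner t x) unitary_groupVK. Qed.

End UnitaryGroup.

Section Setting.
Context {E Ehat : hilbertType R} {Ep : set E} {theta : {linear E -> E}}.
Context {U : R -> {linear E -> E}} {q : E -> Ehat}.
Context {Uhat : R -> {linear Ehat -> Ehat}}.
Hypothesis hE : reflection_positive_space Ep theta.
Hypothesis hU : reflection_positive_group Ep theta U.
Hypothesis hq : os_completion Ep theta q.
Hypothesis hUhat : os_semigroup Ep U q Uhat.
Hypothesis hcyc : cyclic_subspace U Ep.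

Let gU : unitary_group U := rpg_group hU.
Let sEp : submod_closed [in Ep] := rp_subspace hE.

Lemma rp_stable t x : 0 <= t -> Ep x -> Ep (U t x).
Proof.
rewrite le_eqVlt => /predU1P[<-|t0] Ex; first by rewrite (ug_0 gU).
by apply: (rpg_stable hU t0); exists x.
Qed.

Lemma theta_re_inner (x y : E) : re_inner (theta x) (theta y) = re_inner x y.
Proof. exact: isometry_re_inner (rp_theta_unitary hE). Qed.

Lemma theta_selfadjoint (x y : E) : re_inner (theta x) y = re_inner x (theta y).
Proof. by rewrite -theta_re_inner (rp_theta_invol hE). Qed.

Lemma theta_U t (x : E) : theta (U t x) = U (- t) (theta x).
Proof. by rewrite -(rpg_theta hU) (rp_theta_invol hE). Qed.

Lemma U_theta t (x : E) : U t (theta x) = theta (U (- t) x).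
Proof. by rewrite theta_U opprK. Qed.

Lemma osD x y : Ep x -> Ep y -> q (x + y) = q x + q y.
Proof. by move=> Ex Ey; have := os_linear hq 1 Ex Ey; rewrite !scale1r. Qed.

Lemma os0 : q 0 = 0.
Proof.
have /subspaceP[E0 _ _] := sEp.
by have := osD E0 E0; rewrite addr0 -[LHS]addr0 => /addrI.
Qed.

Lemma osZ a x : Ep x -> q (a *: x) = a *: q x.
Proof.
have /subspaceP[E0 _ _] := sEp.
by move=> Ex; have := os_linear hq a Ex E0; rewrite os0 !addr0.
Qed.

Lemma osN x : Ep x -> q (- x) = - q x.
Proof. by move=> Ex; rewrite -(scaleN1r x) osZ // scaleN1r. Qed.

Lemma osB x y : Ep x -> Ep y -> q (x - y) = q x - q y.
Proof. by move=> Ex Ey; rewrite osD ?osN//; apply: subspaceN. Qed.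

(** Polarization of [os_norm]; the form [<x, theta y>] is symmetric since [theta] is selfadjoint. *)
Lemma os_re_inner x y : Ep x -> Ep y ->
  re_inner (q x) (q y) = re_inner x (theta y).
Proof.
have sqr_os z : Ep z -> re_inner (q z) (q z) = re_inner z (theta z).
  by move=> Ez; rewrite {1}/re_inner inner_norm (os_norm hq) // sqrtCK.
move=> Ex Ey; have /subspaceP[_ ED _] := sEp.
have := sqr_os _ (ED _ _ Ex Ey); rewrite osD // raddfD !re_innerE !sqr_os //.
rewrite (re_innerC (q y) (q x)) -(theta_selfadjoint y x) (re_innerC _ x).
lra.
Qed.

Lemma os_inner x y : Ep x -> Ep y -> inner (q x) (q y) = inner x (theta y).
Proof.
move=> Ex Ey; have /subspaceP[_ _ EZ] := sEp.
apply: inner_ext; first exact: os_re_inner.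
by rewrite -osZ // os_re_inner //; apply: EZ.
Qed.

(** On [Ep] this says [|q x| <= |x|], which bounds the functional represented in [fixed_os_surj]. *)
Lemma re_inner_theta_le x : re_inner x (theta x) <= re_inner x x.
Proof.
have := re_inner_young x (theta x) ltr01.
by rewrite theta_re_inner invr1; lra.
Qed.

Lemma Uhat_symmetric t x (w : Ehat) : 0 <= t -> Ep x ->
  re_inner (Uhat t (q x)) w = re_inner (q x) (Uhat t w).
Proof.
move=> t0 Ex.
have sym z y : Ep z -> Ep y ->
    re_inner (Uhat t (q z)) (q y) = re_inner (q z) (Uhat t (q y)).
  move=> Ez Ey; rewrite !(oss_intertwine hUhat) // !os_re_inner //;
    try exact: rp_stable.
  by rewrite unitary_group_adjoint // theta_U.
have contr (v : Ehat) : re_inner (Uhat t v) (Uhat t v) <= re_inner v v.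
  rewrite -lecR -!sqr_normE ler_pXn2r ?nnegrE ?normr_ge0//.
  exact: oss_contraction hUhat _ t0 _.
have half z : Ep z -> re_inner (Uhat t (q z)) w <= re_inner (q z) (Uhat t w).
  move=> Ez; rewrite -subr_le0.
  apply: (@le0_eps _ _ (re_inner (q z) (q z) + 1)) => a a0.
  have [_ [y Ey <-] hy] := dense_approx w (os_dense hq) a0.
  have := sym _ _ Ez Ey; have wE : w = w - q y + q y by rewrite subrK.
  rewrite {}wE; move: (w - q y) hy => h hh symy; rewrite linearD !re_innerE.
  have {hh} : a^-1 * re_inner h h <= a by rewrite ler_pdivrMl // -expr2 ltW.
  have := re_inner_young (Uhat t (q z)) h a0.
  have := re_inner_young (- q z) (Uhat t h) a0.
  have : a^-1 * re_inner (Uhat t h) (Uhat t h) <= a^-1 * re_inner h h.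
    by rewrite ler_pM2l ?invr_gt0.
  have : a * re_inner (Uhat t (q z)) (Uhat t (q z)) <= a * re_inner (q z) (q z).
    by rewrite ler_pM2l.
  rewrite !re_innerE; lra.
(* The inequality at [- x] is the reverse of the one at [x]. *)
have := half _ (subspaceN sEp Ex); have := half _ Ex.
rewrite osN // linearN !re_innerNl; lra.
Qed.

(** For [r <= u], [U_u Ep] lies in [U_r Ep], because [U_u = U_r U_(u - r)]. Hence the union of the
    translates is already a subspace and contains the span. *)
Lemma dense_translates : dense [set x | exists t y, Ep y /\ x = U t y].
Proof.
have /subspaceP[E0 ED EZ] := sEp.
move=> O O0 oO; have [x [Ox Vx]] := hcyc O0 oO; exists x; split=> //.
apply: Vx; split; last by move=> _ [t _ [y Ey <-]]; exists t, y.
apply/subspaceP; split.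
- by exists 0, 0; rewrite linear0.
- move=> _ _ [s [y [Ey ->]]] [t [z [Ez ->]]].
  pose r := Num.min s t.
  have Ur u v : r <= u -> Ep v -> exists2 v', Ep v' & U u v = U r v'.
    move=> ru Ev; exists (U (u - r) v).
      by apply: rp_stable; rewrite ?subr_ge0.
    by rewrite -(ug_add gU) addrC subrK.
  have [|y' Ey' ->] := Ur s y _ Ey; first by rewrite ge_min lexx.
  have [|z' Ez' ->] := Ur t z _ Ez; first by rewrite ge_min lexx orbT.
  by exists r, (y' + z'); rewrite linearD; split=> //; apply: ED.
- move=> a _ [t [y [Ey ->]]]; exists t, (a *: y).
  by rewrite linearZ; split=> //; apply: EZ.
Qed.

(** * Vectors fixed by the group and by the semigroup *)

Lemma fixed_Ep x : fixed_vectors U setT x -> Ep x.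
Proof.
move=> fx; apply: closed_approx (rp_closed hE) _ => r r0.
have [_ [t [y [Ey ->]]] h] := dense_approx x dense_translates r0.
exists y => //; move: h.
by rewrite -{1 2}(fx t) // -linearB unitary_group_re_inner.
Qed.

Lemma fixedB x y : fixed_vectors U setT x -> fixed_vectors U setT y ->
  fixed_vectors U setT (x - y).
Proof. by move=> fx fy t _; rewrite linearB fx ?fy. Qed.

Lemma fixed_theta x : fixed_vectors U setT x -> theta x = x.
Proof.
move=> fx; have ftx : fixed_vectors U setT (theta x).
  by move=> t _; rewrite U_theta fx.
have := rp_ge0 hE (fixed_Ep (fixedB fx ftx)).
rewrite linearB (rp_theta_invol hE) => h; apply/esym/eqP; rewrite -subr_eq0.
apply/eqP; apply: re_inner_eq0; move: h; rewrite lecE => /andP[_ /=].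
by rewrite -[X in _ <= X]/(re_inner _ _) !re_innerE; lra.
Qed.

Lemma fixed_os_surj w : fixed_vectors Uhat [set t | 0 < t] w ->
  exists2 v, fixed_vectors U setT v & q v = w.
Proof.
move=> fw.
have [||x y Ex Ey|r x Ex|x Ex|v Ev hv] :=
  @riesz_subspace _ _ Ep (fun x => re_inner (q x) w) (re_inner w w).
- exact: sEp.
- exact: rp_closed hE.
- by rewrite osD ?re_innerDl.
- by rewrite osZ ?re_innerZl.
- have := re_inner_young (q x) w ltr01; rewrite os_re_inner // invr1.
  by have := re_inner_theta_le x; lra.
have fv0 t : 0 < t -> U t v = v.
  move=> t0; apply/eqP; rewrite -subr_eq0; apply/eqP; apply: re_inner_eq0.
  (* Both sides are values of the functional: [<q (U_t v), w> = <q v, Uhat_t w> = <q v, w>]. Then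
     [|U_t v - v|^2 = 2 |v|^2 - 2 <U_t v, v> = 0]. *)
  have : re_inner (U t v) v = re_inner v v.
    rewrite !hv //; last exact: rp_stable (ltW t0) _.
    rewrite -(oss_intertwine hUhat (ltW t0) Ev) Uhat_symmetric ?(ltW t0)//.
    by rewrite fw.
  rewrite !re_innerE unitary_group_re_inner // (re_innerC v (U t v)); lra.
have fv : fixed_vectors U setT v.
  move=> t _; have [t0|t0|<-] := ltgtP 0 t; [exact: fv0| |exact: (ug_0 gU)].
  by rewrite -{1}(fv0 (- t)) ?oppr_gt0// unitary_groupVK.
exists v => //; apply/eqP; rewrite -subr_eq0; apply/eqP.
(* [<q x, q v> = <x, theta v> = <x, v> = <q x, w>]. *)
apply: (dense_orthogonal (os_dense hq)) => _ [x Ex <-].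
by rewrite re_innerDr re_innerNr os_re_inner // fixed_theta // hv // subrr.
Qed.

(** * Vectors whose whole orbit lies in [Ep] *)

Lemma bigcap_translates :
  \bigcap_(t in [set t : R | 0 < t]) (U t @` Ep) = [set x | forall t, Ep (U t x)].
Proof.
apply/seteqP; split=> [x hx t|x hx t _] /=.
  (* Writing [x] as a translate by [|t| + 1] leaves the nonnegative time [t + |t| + 1], whatever the
     sign of [t]. *)
  have t1 : 0 < `|t| + 1 by have := normr_ge0 t; lra.
  have [y Ey <-] := hx _ t1; rewrite -(ug_add gU); apply: rp_stable => //.
  by have := ler_norm (- t); rewrite normrN; lra.
by exists (U (- t) x) => //; apply: unitary_groupVK.
Qed.

(* <U a y, theta (U b y)> = f (a + b) with f t = <U t y, theta y>; positivity on
   U a (U s y - y) makes f midpoint convex on R, and being bounded, constant. *)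
Lemma orbit_os_constant y s : (forall t, Ep (U t y)) -> q (U s y) = q y.
Proof.
move=> Ey; pose f t := re_inner (U t y) (theta y).
have fE a b : re_inner (U a y) (theta (U b y)) = f (a + b).
  by rewrite theta_U -unitary_group_adjoint // -(ug_add gU) addrC.
have fle t : f t <= re_inner y y.
  have := re_inner_young (U t y) (theta y) ltr01.
  by rewrite theta_re_inner unitary_group_re_inner // invr1 /f; lra.
have Ez r : Ep (U r (U s y - y)).
  rewrite linearB -(ug_add gU); apply: subspaceB sEp _ _; exact: Ey.
have diff r : re_inner (U r (U s y - y)) (theta (U r (U s y - y))) =
    f (r + s + (r + s)) - 2 * f (r + s + r) + f (r + r).
  rewrite linearB -(ug_add gU) linearB !re_innerE !fE (addrC r (r + s)); lra.
(* The form adds the two times, so the second difference at [a] comes from translating by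
   [a / 2]. *)
have f_conv a : 0 <= f (a + s + s) - 2 * f (a + s) + f a.
  have := rp_ge0 hE (Ez (a / 2)); rewrite lecE => /andP[_ /=].
  rewrite -[X in _ <= X]/(re_inner _ _) diff.
  rewrite (_ : a / 2 + s + (a / 2 + s) = a + s + s); last by lra.
  rewrite (_ : a / 2 + s + a / 2 = a + s); last by lra.
  by rewrite (_ : a / 2 + a / 2 = a); last by lra.
(* Both sequences start at [s]: running forward gives [f (2 s) <= f s], running backward gives
   [f 0 <= f s]. *)
have f_up : f (s + s) <= f s.
  have := @convex_bounded_nonincreasing _ (fun n => f (s + n%:R * s))
    (re_inner y y).
  rewrite mul1r mul0r addr0; apply=> n //.
  have := f_conv (s + n%:R * s).
  by congr (0 <= f _ - 2 * f _ + _); rewrite -?natr1; ring.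
have f_down : f 0 <= f s.
  have := @convex_bounded_nonincreasing _ (fun n => f (s - n%:R * s))
    (re_inner y y).
  rewrite mul1r mul0r subr0 subrr; apply=> n //.
  have e1 : s - n.+1%:R * s = s - n.+2%:R * s + s by rewrite -!natr1; ring.
  have e0 : s - n%:R * s = s - n.+2%:R * s + s + s by rewrite -!natr1; ring.
  by rewrite e1 e0; have := f_conv (s - n.+2%:R * s); lra.
(* The square norm of [q (U_s y - y)] is [f (2 s) - 2 f s + f 0], now at most 0. *)
apply/eqP; rewrite -subr_eq0 -osB; [|exact: Ey|by rewrite -(ug_0 gU y)].
apply/eqP; apply: re_inner_eq0; have := Ez 0; rewrite (ug_0 gU) => Ez0.
by rewrite os_re_inner //; have := diff 0; rewrite !(ug_0 gU) !add0r addr0; lra.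
Qed.

Lemma orbit_fixed y : (forall t, Ep (U t y)) -> fixed_vectors U setT y.
Proof.
move=> Ey s _; pose z := U s y - y.
have Ez r : Ep (U r z).
  by rewrite linearB -(ug_add gU); apply: subspaceB sEp _ _; exact: Ey.
(* [U_r z = U_s (U_r y) - U_r y], and [U_r y] again has its orbit in [Ep]. *)
have qz r : q (U r z) = 0.
  rewrite linearB osB//; last by rewrite -(ug_add gU).
  rewrite -(ug_add gU) (addrC r s) (ug_add gU) orbit_os_constant ?subrr// => t.
  by rewrite -(ug_add gU).
have z0 : theta z = 0.
  (* [<U_r x, theta z> = <x, theta (U_r z)> = <q x, q (U_r z)> = 0]. *)
  apply: (dense_orthogonal dense_translates) => _ [r [x [Ex ->]]].
  rewrite unitary_group_adjoint // U_theta -os_re_inner // qz.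
  by rewrite re_innerC re_inner0l.
by apply/eqP; rewrite -subr_eq0 -/z -(rp_theta_invol hE z) z0 linear0.
Qed.

End Setting.
End OsterwalderSchrader.

Theorem proposition4p2p6 (R : realType) (E Ehat : hilbertType R)
    (Ep : set E) (theta : {linear E -> E}) (U : R -> {linear E -> E})
    (q : E -> Ehat) (Uhat : R -> {linear Ehat -> Ehat})
    (hE : reflection_positive_space Ep theta)
    (hU : reflection_positive_group Ep theta U)
    (hq : os_completion Ep theta q)
    (hUhat : os_semigroup Ep U q Uhat)
    (hcyc : cyclic_subspace U Ep) :
  let Efix := fixed_vectors U setT in
  let Ehatfix := fixed_vectors Uhat [set t | 0 < t] in
  let E0 := [set x | Ep x /\ theta x = x] in
  let Einfty := \bigcap_(t in [set t : R | 0 < t]) (U t @` Ep) in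
  [/\ Efix `<=` E0,
      unitary_iso Efix Ehatfix q
    & Efix = Einfty].
Proof.
move=> Efix Ehatfix E0 Einfty.
have fEp x : Efix x -> Ep x := fixed_Ep hE hU hcyc (x := x).
have fth x : Efix x -> theta x = x := fixed_theta hE hU hcyc (x := x).
have qI x y : Efix x -> Efix y -> inner (q x) (q y) = inner x y.
  by move=> fx fy; rewrite (os_inner hE hq) ?fth //; apply: fEp.
split; first by move=> x fx; split; [exact: fEp|exact: fth].
- split=> //; first by move=> a x y /fEp Ex /fEp Ey; apply: (os_linear hq).
  split.
  + move=> x fx t t0.
    by rewrite (oss_intertwine hUhat (ltW t0) (fEp _ fx)) fx.
  + move=> x y /set_mem fx /set_mem fy qxy.
    have fxy := fixedB fx fy.
    (* Injectivity: [x - y] is fixed, so [|x - y|] equals the norm of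
       [q (x - y) = q x - q y = 0]. *)
    apply/eqP; rewrite -subr_eq0 -normr_eq0 -sqrf_eq0 -inner_norm -qI //.
    by rewrite (osB hE hq) ?qxy ?subrr ?linear0l//; apply: fEp.
  + by move=> w /(fixed_os_surj hE hU hq hUhat hcyc)[v fv <-]; exists v.
- rewrite /Einfty (bigcap_translates hU); apply/seteqP; split=> x.
    by move=> fx t /=; rewrite fx //; apply: fEp.
  exact: (orbit_fixed hE hU hq hcyc).
Qed.
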